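(* Let $m$ be a positive integer and let $\xi,\eta$ be positive irrational numbers with $\xi\eta=m$. Let $n,k\ge 1$ be integers such that the triplets $\left(\frac{p_{n-1}}{q_{n-1}},\xi_n,b_n\right)$ of $\xi$ and $\left(\frac{P_{k-1}}{Q_{k-1}},\eta_k,B_k\right)$ of $\eta$ are connected. Then there exist positive integers $r,s$ such that $rs=m$ and $$-2r+2\le r\,b_n-s\,B_k\le 2s-2.$$
   Context: For a positive irrational number $\xi$, the regular continued fraction expansion is defined by $\xi_0=\xi$, $b_0=\lfloor \xi\rfloor$, and $\xi_j=\frac{1}{\xi_{j-1}-b_{j-1}}$, $b_j=\lfloor \xi_j\rfloor$ for $j\ge1$. The $\xi_j$ are the complete quotients and the $b_j$ the partial quotients. The convergents $\frac{p_j}{q_j}$ are given by $p_{-1}=1$, $q_{-1}=0$, $p_0=b_0$, $q_0=1$, and $p_j=b_jp_{j-1}+p_{j-2}$, $q_j=b_jq_{j-1}+q_{j-2}$ for $j\ge 1$. For $\eta=m/\xi$, the complete quotients, partial quotients and convergents, defined in the same way, are denoted $\eta_j$, $B_j$, $\frac{P_j}{Q_j}$. For integers $n,k\ge1$, the triplets $\left(\frac{p_{n-1}}{q_{n-1}},\xi_n,b_n\right)$ and $\left(\frac{P_{k-1}}{Q_{k-1}},\eta_k,B_k\right)$ are called connected if $\frac{p_{n-1}}{q_{n-1}}\cdot\frac{P_{k-1}}{Q_{k-1}}=m$. *)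

(* Defs.v *)
From mathcomp Require Import all_boot all_order all_algebra.
From mathcomp Require Import classical_sets reals.

Set Implicit Arguments.
Unset Strict Implicit.
Unset Printing Implicit Defensive.

Import Order.TTheory GRing.Theory Num.Theory.
Local Open Scope ring_scope.

Fixpoint complete_quotient (R : realType) (x : R) (j : nat) : R :=
  if j is i.+1 then
    let y := complete_quotient x i in (y - (Num.floor y)%:~R)^-1
  else x.

Definition partial_quotient (R : realType) (x : R) (j : nat) : int :=
  Num.floor (complete_quotient x j).

(* The pair (u_j, u_{j-1}) for the recurrence u_j = b_j u_{j-1} + u_{j-2}
   (j >= 1), with initial values u_0 = u0 and u_{-1} = um1. *)
Fixpoint convergent_rec (b : nat -> int) (u0 um1 : int) (j : nat) : int * int :=
  if j is i.+1 then
    let: (u, u') := convergent_rec b u0 um1 i in (b j * u + u', u)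
  else (u0, um1).

Definition convergent_num (R : realType) (x : R) (j : nat) : int :=
  (convergent_rec (partial_quotient x) (partial_quotient x 0%N) 1 j).1.

Definition convergent_den (R : realType) (x : R) (j : nat) : int :=
  (convergent_rec (partial_quotient x) 1 0 j).1.

Definition convergent (R : realType) (x : R) (j : nat) : R :=
  (convergent_num x j)%:~R / (convergent_den x j)%:~R.

(* Meant for n >= 1 only: the truncated predecessor n.-1 is then n - 1. *)
Definition triplet (R : realType) (x : R) (n : nat) : R * R * int :=
  (convergent x n.-1, complete_quotient x n, partial_quotient x n).

Definition connected_triplets (R : realType) (m : nat)
    (t t' : R * R * int) : Prop :=
  t.1.1 * t'.1.1 = m%:R.

(* Main.v *)
Require Import Defs.
From mathcomp Require Import all_boot all_order all_algebra.
From mathcomp Require Import classical_sets reals.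
From mathcomp Require Import zify ring lra.

Set Implicit Arguments.
Unset Strict Implicit.
Unset Printing Implicit Defensive.

(** Write [p/q], [p'/q'] for the convergents of [xi] of indices [n-1], [n-2],
    and [P/Q], [P'/Q'] for those of [eta] of indices [k-1], [k-2].  As [p/q] and
    [P/Q] are in lowest terms, the connection [p P = m q Q] forces [p = r Q] and
    [P = s q] with [r s = m] ([cofactors_of_prod]); these are the [r] and [s] of
    the theorem.

    Since [xi eta] equals the product of the two convergents, one convergent
    lies below its limit and the other above it, so [n] and [k] have opposite
    parities ([connected_parity]) and the determinants [p q' - p' q] and
    [P Q' - P' Q] are opposite signs.  Multiplying the expressions of [xi]
    and [eta] as homographic functions of [xi_n] and [eta_k] then makes the term
    in [xi_n eta_k] cancel and leaves an affine relation: [r xi_n - s eta_k] is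
    an integer [t] ([complete_quotient_offset]), and
    [Q t = s Q' - p'], [q t = P' - r q'].

    The first of these equations gives [t <= s], the second [t >= - r], and the
    extreme values would make a determinant vanish ([offset_lt]); hence
    [- r < t < s].  Taking floors,
    [r b_n - s B_k = t - r {xi_n} + s {eta_k}] lies strictly between [t - r]
    and [t + s], and since everything is an integer the stated bounds follow. *)

Import Order.TTheory GRing.Theory Num.Theory.
Local Open Scope ring_scope.

(** * Integer arithmetic of the two determinants *)

Lemma cofactors_of_prod (p1 q1 p2 q2 m : int) :
  0 < q1 -> 0 < q2 -> coprimez q1 p1 -> coprimez q2 p2 ->
  p1 * p2 = m * (q1 * q2) ->
  exists r s : int, [/\ p1 = r * q2, p2 = s * q1 & r * s = m].
Proof.
move=> q1_gt0 q2_gt0 cop1 cop2 E.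
have /dvdzP[s p2E] : (q1 %| p2)%Z.
  by rewrite -(Gauss_dvdzr _ cop1) E; apply/dvdzP; exists (m * q2); ring.
have /dvdzP[r p1E] : (q2 %| p1)%Z.
  by rewrite -(Gauss_dvdzl _ cop2) E; apply/dvdzP; exists (m * q1); ring.
exists r, s; split=> //; apply: (@mulIf _ (q1 * q2)).
  by rewrite mulf_neq0 ?gt_eqF.
by rewrite -E p1E p2E; ring.
Qed.

(** The bound [t <= s] holds because [Q t = s Q' - p' <= s Q].  If it is attained
    then [p' = 0], and [s q + r q' = P' <= s q] forces [q' = 0], so that the
    determinant vanishes.  Exchanging the two expansions replaces [t] by [- t] and
    yields the lower bound [- r < t]. *)
Lemma offset_lt (r s p' q q' P' Q Q' t : int) :
  0 < r -> 0 < s -> 0 < q -> 0 < Q ->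
  0 <= p' -> 0 <= q' -> Q' <= Q -> P' <= s * q ->
  r * Q * q' - p' * q != 0 ->
  Q * t = s * Q' - p' -> q * t = P' - r * q' -> t < s.
Proof.
move=> r0 s0 q0 Q0 p'0 q'0 Q'Q P'P det Qt qt.
have t_le : t <= s by rewrite -(ler_pM2l Q0); nia.
rewrite lt_neqAle t_le andbT; apply/eqP => tE; subst t.
have p'E : p' = 0 by nia.
have q'E : q' = 0 by nia.
by move: det; rewrite p'E q'E mulr0 mul0r subr0 eqxx.
Qed.

(** The coefficients of [z] and [w] in the difference of the two sides of the
    product equation are, up to the factors [r] and [s], the two determinants;
    as these are opposite units, the combination [r z - s w] appears. *)
Lemma complete_quotient_offset (R : realType) (e p' q' P' Q' q Q r s : int)
    (z w : R) :
  e * e = 1 -> r * Q * q' - p' * q = e -> s * q * Q' - P' * Q = - e ->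
  ((r * Q)%:~R * z + p'%:~R) * ((s * q)%:~R * w + P'%:~R)
  = (r * s)%:~R * (q%:~R * z + q'%:~R) * (Q%:~R * w + Q'%:~R) ->
  r%:~R * z - s%:~R * w = (e * (r * s * q' * Q' - p' * P'))%:~R.
Proof.
move=> ee det det' E.
have {}ee : e%:~R * e%:~R = 1 :> R by rewrite -intrM ee.
transitivity (e%:~R * (e%:~R * (r%:~R * z - s%:~R * w))).
  by rewrite mulrA ee mul1r.
rewrite intrM; congr (_ * _).
rewrite mulrBr.
have -> : e%:~R * (r%:~R * z) = - (s * q * Q' - P' * Q)%:~R * (r%:~R * z) :> R.
  by rewrite det' rmorphN opprK.
rewrite -det; move: E; rewrite !(intrB, intrM) => E.
apply/eqP; rewrite -subr_eq0; apply/eqP.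
rewrite -(subrr (r%:~R * s%:~R * (q%:~R * z + q'%:~R) * (Q%:~R * w + Q'%:~R))).
rewrite -{1}E; ring.
Qed.

(** * Regular continued fractions *)

(** The second component of the recurrence state is used in place of
    [convergent_num x j.-1], so that index [0] yields the initial value of
    index [-1]. *)
Definition convergent_num_prev (R : realType) (x : R) (j : nat) : int :=
  (convergent_rec (partial_quotient x) (partial_quotient x 0%N) 1 j).2.

Definition convergent_den_prev (R : realType) (x : R) (j : nat) : int :=
  (convergent_rec (partial_quotient x) 1 0 j).2.

Local Notation z := complete_quotient.
Local Notation b := partial_quotient.
Local Notation p := convergent_num.
Local Notation q := convergent_den.
Local Notation p' := convergent_num_prev.
Local Notation q' := convergent_den_prev.

Lemma convergent_numS (R : realType) (x : R) j :
  p x j.+1 = b x j.+1 * p x j + p' x j.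
Proof. by rewrite /p /p' /=; case: convergent_rec. Qed.

Lemma convergent_num_prevS (R : realType) (x : R) j : p' x j.+1 = p x j.
Proof. by rewrite /p /p' /=; case: convergent_rec. Qed.

Lemma convergent_denS (R : realType) (x : R) j :
  q x j.+1 = b x j.+1 * q x j + q' x j.
Proof. by rewrite /q /q' /=; case: convergent_rec. Qed.

Lemma convergent_den_prevS (R : realType) (x : R) j : q' x j.+1 = q x j.
Proof. by rewrite /q /q' /=; case: convergent_rec. Qed.

Definition convergentE :=
  (convergent_numS, convergent_denS, convergent_num_prevS, convergent_den_prevS).

Lemma complete_quotient_irrational (R : realType) (x : R) j :
  irrational x -> irrational (z x j).
Proof.
move=> x_irr; elim: j => [//|j IH] /= [c _ cE]; apply: IH.
exists (c^-1 + (b x j)%:~R) => //.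
by rewrite rmorphD fmorphV /= ratr_int cE invrK subrK.
Qed.

Lemma frac_complete_quotient_gt0 (R : realType) (x : R) j :
  irrational x -> 0 < z x j - (b x j)%:~R.
Proof.
move=> x_irr; rewrite lt_neqAle subr_ge0 floor_le andbT eq_sym subr_eq0.
have z_irr : ~ rational (z x j) := complete_quotient_irrational (j := j) x_irr.
apply/eqP => zE; apply: z_irr.
by exists (b x j)%:~R; rewrite // ratr_int -zE.
Qed.

Lemma complete_quotient_gt1 (R : realType) (x : R) j :
  irrational x -> 1 < z x j.+1.
Proof.
move=> x_irr; rewrite /= invf_gt1 ?frac_complete_quotient_gt0//.
by have := floorD1_gt (z x j); rewrite intrD ltrBlDl.
Qed.

Lemma partial_quotient_ge1 (R : realType) (x : R) j :
  irrational x -> 1 <= b x j.+1.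
Proof. by move=> x_irr; rewrite floor_ge_int ltW ?complete_quotient_gt1. Qed.

Lemma convergent_det (R : realType) (x : R) j :
  p x j * q' x j - p' x j * q x j = (-1) ^+ j.+1.
Proof.
elim: j => [|j IH]; first by rewrite /p /p' /q /q' /=; ring.
by rewrite !convergentE exprS -IH; ring.
Qed.

(** [x] is the image of its complete quotient under the homography whose
    coefficients are two successive convergents. *)
Lemma convergent_tail (R : realType) (x : R) j : irrational x ->
  x * ((q x j)%:~R * z x j.+1 + (q' x j)%:~R)
  = (p x j)%:~R * z x j.+1 + (p' x j)%:~R.
Proof.
move=> x_irr.
have zS i : z x i * z x i.+1 = (b x i)%:~R * z x i.+1 + 1.
  have /lt0r_neq0 f_neq0 := frac_complete_quotient_gt0 i x_irr.
  by rewrite -[in LHS](subrK (b x i)%:~R (z x i)) mulrDl mulfV// addrC.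
elim: j => [|j IH]; first by rewrite mul1r addr0; exact: (zS 0%N).
rewrite !convergentE !intrD !intrM.
have -> : x * (((b x j.+1)%:~R * (q x j)%:~R + (q' x j)%:~R) * z x j.+2
             + (q x j)%:~R)
  = x * ((q x j)%:~R * ((b x j.+1)%:~R * z x j.+2 + 1)
         + (q' x j)%:~R * z x j.+2) by ring.
rewrite -zS.
have -> : (q x j)%:~R * (z x j.+1 * z x j.+2) + (q' x j)%:~R * z x j.+2
  = ((q x j)%:~R * z x j.+1 + (q' x j)%:~R) * z x j.+2 by ring.
by rewrite mulrA IH mulrDl -mulrA zS; ring.
Qed.

Lemma convergent_den_bounds (R : realType) (x : R) j : irrational x ->
  [/\ 0 < q x j, 0 <= q' x j & q' x j <= q x j].
Proof.
move=> x_irr; elim: j => [//|j [q0 q'0 _]].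
have := partial_quotient_ge1 j x_irr.
by rewrite !convergentE => b1; split; nia.
Qed.

(** The condition [0 < p x j] excludes only [j = 0] with [x < 1], where
    [p_0 = 0] and [p_(-1) = 1]. *)
Lemma convergent_num_bounds (R : realType) (x : R) j :
  0 < x -> irrational x ->
  [/\ 0 <= p x j, 0 <= p' x j & 0 < p x j -> p' x j <= p x j].
Proof.
move=> x_gt0 x_irr; elim: j => [|j [p0 p'0 _]].
  by split; rewrite // floor_ge0 ltW.
have := partial_quotient_ge1 j x_irr.
by rewrite !convergentE => b1; split; nia.
Qed.

(** The convergents lie alternately below and above [x]: by [convergent_tail],
    [p_j - x q_j] times the positive [q_j x_(j+1) + q_(j-1)] is the
    determinant. *)
Lemma convergent_error_gt0 (R : realType) (x : R) j : irrational x ->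
  0 < (-1) ^+ j.+1 * ((p x j)%:~R - x * (q x j)%:~R).
Proof.
move=> x_irr.
have [q0 q'0 _] := convergent_den_bounds j x_irr.
have z1 := complete_quotient_gt1 j x_irr.
have d_gt0 : 0 < (q x j)%:~R * z x j.+1 + (q' x j)%:~R :> R.
  by rewrite ltr_wpDr ?ler0z// mulr_gt0 ?ltr0z// (lt_trans ltr01).
rewrite -(pmulr_lgt0 _ d_gt0) -mulrA mulrBl.
rewrite -mulrA [in X in _ - X]mulrCA convergent_tail//.
have -> : (p x j)%:~R * ((q x j)%:~R * z x j.+1 + (q' x j)%:~R)
   - (q x j)%:~R * ((p x j)%:~R * z x j.+1 + (p' x j)%:~R)
  = (p x j * q' x j - p' x j * q x j)%:~R :> R by rewrite intrB !intrM; ring.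
by rewrite convergent_det rmorphXn/= rmorphN1 -exprMn mulrNN mulr1 expr1n.
Qed.

Lemma convergent_coprime (R : realType) (x : R) j : coprimez (q x j) (p x j).
Proof.
apply/coprimezP; exists (- (-1) ^+ j.+1 * p' x j, (-1) ^+ j.+1 * q' x j) => /=.
transitivity ((-1) ^+ j.+1 * (p x j * q' x j - p' x j * q x j)); first by ring.
by rewrite convergent_det -exprMn mulrNN mulr1 expr1n.
Qed.

(** * Connected triplets *)

(** If both convergents were on the same side of their limits, their product
    could not be [m = xi eta]. *)
Lemma connected_parity (R : realType) (m : nat) (xi eta : R) i j :
  0 < xi -> 0 < eta -> irrational xi -> irrational eta ->
  xi * eta = m%:R -> 0 <= p xi i -> 0 <= p eta j ->
  p xi i * p eta j = m%:Z * (q xi i * q eta j) ->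
  odd j = ~~ odd i.
Proof.
move=> xi_gt0 eta_gt0 xi_irr eta_irr xi_eta p0 P0 E.
have [q0 _ _] := convergent_den_bounds i xi_irr.
have [Q0 _ _] := convergent_den_bounds j eta_irr.
have {E} : (p xi i)%:~R * (p eta j)%:~R
    = (xi * (q xi i)%:~R) * (eta * (q eta j)%:~R) :> R.
  by rewrite mulrACA xi_eta -!intrM E !intrM pmulrn.
have := convergent_error_gt0 i xi_irr; have := convergent_error_gt0 j eta_irr.
have : 0 <= (p xi i)%:~R :> R by rewrite ler0z.
have : 0 <= (p eta j)%:~R :> R by rewrite ler0z.
have : 0 < xi * (q xi i)%:~R :> R by rewrite mulr_gt0// ltr0z.
have : 0 < eta * (q eta j)%:~R :> R by rewrite mulr_gt0// ltr0z.
rewrite !exprS -(signr_odd _ i) -(signr_odd _ j).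
by case: (odd i); case: (odd j) => //=; rewrite ?expr0 ?expr1; nra.
Qed.

Theorem theorem2p6 (R : realType) (m : nat) (xi eta : R) (n k : nat)
    (m_gt0 : (0 < m)%N)
    (xi_gt0 : 0 < xi) (xi_irr : irrational xi)
    (eta_gt0 : 0 < eta) (eta_irr : irrational eta)
    (xi_eta : xi * eta = m%:R)
    (n_ge1 : (1 <= n)%N) (k_ge1 : (1 <= k)%N)
    (conn : connected_triplets m (triplet xi n) (triplet eta k)) :
  exists r s : nat,
    [/\ (0 < r)%N, (0 < s)%N, (r * s)%N = m &
        - 2 * r%:Z + 2 <= r%:Z * partial_quotient xi n
                          - s%:Z * partial_quotient eta k
                       <= 2 * s%:Z - 2].
Proof.
case: n n_ge1 conn => // i _; case: k k_ge1 => // j _.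
rewrite /connected_triplets /= => conn.
have [p0 p'0 p'p] := convergent_num_bounds i xi_gt0 xi_irr.
have [P0 P'0 P'P] := convergent_num_bounds j eta_gt0 eta_irr.
have [q0 q'0 q'q] := convergent_den_bounds i xi_irr.
have [Q0 Q'0 Q'Q] := convergent_den_bounds j eta_irr.
have E : p xi i * p eta j = m%:Z * (q xi i * q eta j).
  apply/eqP; rewrite -(eqr_int R) !intrM -pmulrn -conn /convergent.
  by apply/eqP; field; rewrite !intr_eq0 !gt_eqF.
have parity :=
  connected_parity xi_gt0 eta_gt0 xi_irr eta_irr xi_eta p0 P0 E.
have p_gt0 : 0 < p xi i by nia.
have P_gt0 : 0 < p eta j by nia.
have [r [s [pE PE rsE]]] := cofactors_of_prod q0 Q0
  (convergent_coprime xi i) (convergent_coprime eta j) E.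
have r_gt0 : 0 < r by nia.
have s_gt0 : 0 < s by nia.
have det := convergent_det xi i.
have det' : p eta j * q' eta j - p' eta j * q eta j = - (-1) ^+ i.+1.
  by rewrite convergent_det !exprS -signr_odd parity signrN signr_odd; ring.
have /andP[b_le b_gt] := floor_itv (z xi i.+1).
have /andP[B_le B_gt] := floor_itv (z eta j.+1).
have := congr2 *%R (convergent_tail i xi_irr) (convergent_tail j eta_irr).
rewrite mulrACA xi_eta pmulrn -rsE pE PE.
rewrite pE in det; rewrite PE in det'.
move=> /esym tails.
have ee : (-1) ^+ i.+1 * (-1) ^+ i.+1 = 1 :> int.
  by rewrite -exprMn mulrNN mulr1 expr1n.
rewrite [RHS]mulrA in tails.
set e : int := (-1) ^+ i.+1 in det det' ee.
have := complete_quotient_offset ee det det' tails.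
set t : int := _ * (_ - _) => tE.
(* Factoring out [e * e = 1] leaves one copy of [e] and one of [- e] to be
   replaced by the two determinants. *)
have Qt : q eta j * t = s * q' eta j - p' xi i.
  transitivity (e * e * (s * q' eta j - p' xi i)); last by rewrite ee mul1r.
  have -> : e * e * (s * q' eta j - p' xi i)
    = e * (s * q' eta j * e + p' xi i * - e) by ring.
  by rewrite -det' -[in s * _ * e]det /t; ring.
have qt : q xi i * t = p' eta j - r * q' xi i.
  transitivity (e * e * (p' eta j - r * q' xi i)); last by rewrite ee mul1r.
  have -> : e * e * (p' eta j - r * q' xi i)
    = e * (p' eta j * e + r * q' xi i * - e) by ring.
  by rewrite -det' -[in p' eta j * e]det /t; ring.
clearbody t.
have t_lt : t < s.
  apply: (offset_lt (r := r) (p' := p' xi i) (q := q xi i) (q' := q' xi i)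
     (P' := p' eta j) (Q := q eta j) (Q' := q' eta j)) => //.
  - by rewrite -PE P'P.
  - by rewrite det /e signr_eq0.
have t_gt : - t < r.
  apply: (offset_lt (r := s) (p' := p' eta j) (q := q eta j) (q' := q' eta j)
     (P' := p' xi i) (Q := q xi i) (Q' := q' xi i)) => //.
  - by rewrite -pE p'p.
  - by rewrite det' oppr_eq0 /e signr_eq0.
  - by rewrite mulrN qt opprB.
  - by rewrite mulrN Qt opprB.
have rR : 0 < r%:~R :> R by rewrite ltr0z.
have sR : 0 < s%:~R :> R by rewrite ltr0z.
have diff_lt : r * b xi i.+1 - s * b eta j.+1 < t + s.
  rewrite -(ltr_int R) intrB intrD !intrM -tE.
  move: B_gt; rewrite intrD => B_gt; nra.
have diff_gt : t - r < r * b xi i.+1 - s * b eta j.+1.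
  rewrite -(ltr_int R) !intrB !intrM -tE.
  move: b_gt; rewrite intrD => b_gt; nra.
exists `|r|%N, `|s|%N.
rewrite !absz_gt0 !gt_eqF// !gtz0_abs//.
by split=> //; [lia | apply/andP; split; lia].
Qed.
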